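(* $LTS(\mathrm{CLL}_R)$ is $\tau$-pure: for every process $p$, if $p\stackrel{\tau}{\longrightarrow}q$ for some $q$, then there is no $a\in Act$ and no $q'$ with $p\stackrel{a}{\longrightarrow}q'$.
   Context: Fix a set $Act$ of visible actions and let $Act_\tau=Act\cup\{\tau\}$; $a$ ranges over $Act$, $\alpha$ over $Act_\tau$. Terms of $\mathrm{CLL}_R$: $t::=0\mid\bot\mid\alpha.t\mid t\Box t\mid t\wedge t\mid t\vee t\mid t\parallel_A t\mid X\mid\langle X|E\rangle$, where $X$ is a variable, $A\subseteq Act$, and $E$ is a recursive specification, i.e. a finite nonempty set of equations $\{Y=t_Y:Y\in V\}$ over a set $V$ of variables with $X\in V$ (variables of $V$ are bound in $\langle X|E\rangle$; recursive variables of distinct specifications are distinct and never occur free). A process is a closed term. For $E$ over $V$, $\langle t|E\rangle$ is $t$ with every free occurrence of each $Y\in V$ replaced by $\langle Y|E\rangle$. All recursive specifications are assumed guarded: every occurrence of every $Y\in V$ in every right-hand side of $E$ lies within a subterm $\alpha.t'$ or $t_1\vee t_2$. $LTS(\mathrm{CLL}_R)$ has the processes as states, transitions $\stackrel{\alpha}{\longrightarrow}$ and inconsistency predicate $F$ given by the unique stable model of the following stratified transition system specification ($x\not\stackrel{\alpha}{\longrightarrow}$: no $\alpha$-transition; $z\stackrel{\epsilon}{\Longrightarrow}|y$: $z(\stackrel{\tau}{\longrightarrow})^*y$ and $y\not\stackrel{\tau}{\longrightarrow}$). Operational rules: $\alpha.x\stackrel{\alpha}{\to}x$; if $x_1\stackrel{a}{\to}y_1$,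 $x_2\not\stackrel{\tau}{\to}$ then $x_1\Box x_2\stackrel a\to y_1$ and $x_2\Box x_1\stackrel a\to y_1$; if $x_1\stackrel\tau\to y_1$ then $x_1\Box x_2\stackrel\tau\to y_1\Box x_2$, $x_2\Box x_1\stackrel\tau\to x_2\Box y_1$, $x_1\wedge x_2\stackrel\tau\to y_1\wedge x_2$, $x_2\wedge x_1\stackrel\tau\to x_2\wedge y_1$, $x_1\parallel_A x_2\stackrel\tau\to y_1\parallel_A x_2$, $x_2\parallel_A x_1\stackrel\tau\to x_2\parallel_A y_1$; if $x_1\stackrel a\to y_1$, $x_2\stackrel a\to y_2$ then $x_1\wedge x_2\stackrel a\to y_1\wedge y_2$, and if also $a\in A$ then $x_1\parallel_A x_2\stackrel a\to y_1\parallel_A y_2$; if $a\notin A$, $x_1\stackrel a\to y_1$, $x_2\not\stackrel\tau\to$ then $x_1\parallel_A x_2\stackrel a\to y_1\parallel_A x_2$ and $x_2\parallel_A x_1\stackrel a\to x_2\parallel_A y_1$; $x_1\vee x_2\stackrel\tau\to x_1$, $x_1\vee x_2\stackrel\tau\to x_2$; if $Y=t_Y\in E$ and $\langle t_Y|E\rangle\stackrel\alpha\to y$ then $\langle Y|E\rangle\stackrel\alpha\to y$. Predicate rules: $\bot\in F$; $x\in F\Rightarrow\alpha.x\in F$; $x_1,x_2\in F\Rightarrow x_1\vee x_2\in F$; if $x_1\in F$ or $x_2\in F$ then $x_1\Box x_2, x_1\parallel_A x_2, x_1\wedge x_2\in F$; if $x_1\wedge x_2\not\stackrel\tau\to$ and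 one of $x_1,x_2$ has an $a$-transition while the other has none, then $x_1\wedge x_2\in F$; if $x_1\wedge x_2\stackrel\alpha\to z$ for some $z$ and all $y$ with $x_1\wedge x_2\stackrel\alpha\to y$ are in $F$, then $x_1\wedge x_2\in F$; if all $y$ with $x_1\wedge x_2\stackrel\epsilon\Longrightarrow|y$ are in $F$ then $x_1\wedge x_2\in F$; if $Y=t_Y\in E$ and $\langle t_Y|E\rangle\in F$ then $\langle Y|E\rangle\in F$; if all $y$ with $\langle Y|E\rangle\stackrel\epsilon\Longrightarrow|y$ are in $F$ then $\langle Y|E\rangle\in F$. *)

(* Defs.v *)
From Stdlib Require Import List Sorting.Sorted ListSet PeanoNat Relations.

Set Implicit Arguments.
Unset Strict Implicit.

(** * Labelled transition systems with an inconsistency predicate *)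

Inductive label (Act : Type) : Type :=
| vis (a : Act)
| tau.
Arguments tau {Act}.

Record lts (Act S : Type) : Type := Lts {
  trans : S -> label Act -> S -> Prop;
  incons : S -> Prop }.

Definition can (Act S : Type) (L : lts Act S) (p : S) (al : label Act) : Prop :=
  exists q, trans L p al q.

(* [p ==eps==>| q]. *)
Definition eps_stable (Act S : Type) (L : lts Act S) (p q : S) : Prop :=
  clos_refl_trans S (fun x y => trans L x tau y) p q /\ ~ can L q tau.

Definition tau_pure (Act S : Type) (L : lts Act S) : Prop :=
  forall p, can L p tau -> ~ exists a, can L p (vis a).

(** * Terms *)

Definition var := nat.

(* In [Rec X E] the list [E] holds the equations [Y = t_Y] of a recursive
   specification as pairs [(Y, t_Y)], all of whose left-hand sides are bound. *)
Inductive term (Act : Type) : Type :=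
| Zero
| Bot
| Prefix (al : label Act) (t : term Act)
| Box (t u : term Act)
| Conj (t u : term Act)
| Disj (t u : term Act)
| Par (A : Act -> Prop) (t u : term Act)
| Var (X : var)
| Rec (X : var) (E : list (var * term Act)).
Arguments Zero {Act}.
Arguments Bot {Act}.
Arguments Var {Act} X.

Definition spec (Act : Type) := list (var * term Act).

Definition dom (Act : Type) (E : spec Act) : list var := map fst E.

Inductive free_in (Act : Type) (Z : var) : term Act -> Prop :=
| free_prefix al t : free_in Z t -> free_in Z (Prefix al t)
| free_box_l t u : free_in Z t -> free_in Z (Box t u)
| free_box_r t u : free_in Z u -> free_in Z (Box t u)
| free_conj_l t u : free_in Z t -> free_in Z (Conj t u)
| free_conj_r t u : free_in Z u -> free_in Z (Conj t u)
| free_disj_l t u : free_in Z t -> free_in Z (Disj t u)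
| free_disj_r t u : free_in Z u -> free_in Z (Disj t u)
| free_par_l A t u : free_in Z t -> free_in Z (Par A t u)
| free_par_r A t u : free_in Z u -> free_in Z (Par A t u)
| free_var : free_in Z (Var Z)
| free_rec X (E : spec Act) Y t :
    In (Y, t) E -> free_in Z t -> ~ In Z (dom E) -> free_in Z (Rec X E).

Definition closed (Act : Type) (t : term Act) : Prop := forall Z, ~ free_in Z t.

(* [Z] has a free occurrence in the term that lies within no subterm
   [Prefix al t] and no subterm [Disj t u]. *)
Inductive unguarded_in (Act : Type) (Z : var) : term Act -> Prop :=
| ung_box_l t u : unguarded_in Z t -> unguarded_in Z (Box t u)
| ung_box_r t u : unguarded_in Z u -> unguarded_in Z (Box t u)
| ung_conj_l t u : unguarded_in Z t -> unguarded_in Z (Conj t u)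
| ung_conj_r t u : unguarded_in Z u -> unguarded_in Z (Conj t u)
| ung_par_l A t u : unguarded_in Z t -> unguarded_in Z (Par A t u)
| ung_par_r A t u : unguarded_in Z u -> unguarded_in Z (Par A t u)
| ung_var : unguarded_in Z (Var Z)
| ung_rec X (E : spec Act) Y t :
    In (Y, t) E -> unguarded_in Z t -> ~ In Z (dom E) -> unguarded_in Z (Rec X E).

Definition guarded (Act : Type) (E : spec Act) : Prop :=
  forall Y t Z, In (Y, t) E -> In Z (dom E) -> ~ unguarded_in Z t.

(* The left-hand sides are listed in strictly increasing order, so that each
   finite set of equations with one equation per variable is represented by
   exactly one list.  Different specifications may use the same variable: the
   usual convention that they do not is only a choice of names of bound
   variables, and [subst_rec] respects scopes. *)
Inductive well_formed (Act : Type) : term Act -> Prop :=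
| wf_zero : well_formed Zero
| wf_bot : well_formed Bot
| wf_prefix al t : well_formed t -> well_formed (Prefix al t)
| wf_box t u : well_formed t -> well_formed u -> well_formed (Box t u)
| wf_conj t u : well_formed t -> well_formed u -> well_formed (Conj t u)
| wf_disj t u : well_formed t -> well_formed u -> well_formed (Disj t u)
| wf_par A t u : well_formed t -> well_formed u -> well_formed (Par A t u)
| wf_var X : well_formed (Var X)
| wf_rec X (E : spec Act) :
    In X (dom E) -> StronglySorted lt (dom E) -> guarded E ->
    (forall Y t, In (Y, t) E -> well_formed t) -> well_formed (Rec X E).

(* Replaces every free occurrence in [t] of each [Y] in [V] by [<Y|E>].  Under a
   nested specification the variables bound there are removed from [V].  No
   variable can be captured when the terms [<Y|E>] are closed. *)
Fixpoint subst_rec (Act : Type) (E : spec Act) (V : list var) (t : term Act) :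
    term Act :=
  match t with
  | Zero => Zero
  | Bot => Bot
  | Prefix al t => Prefix al (subst_rec E V t)
  | Box t u => Box (subst_rec E V t) (subst_rec E V u)
  | Conj t u => Conj (subst_rec E V t) (subst_rec E V u)
  | Disj t u => Disj (subst_rec E V t) (subst_rec E V u)
  | Par A t u => Par A (subst_rec E V t) (subst_rec E V u)
  | Var Y => if in_dec Nat.eq_dec Y V then Rec Y E else Var Y
  | Rec X G =>
      let W := set_diff Nat.eq_dec V (map fst G) in
      Rec X (map (fun e => (fst e, subst_rec E W (snd e))) G)
  end.

(* [<t|E>]. *)
Definition unfold_rec (Act : Type) (t : term Act) (E : spec Act) : term Act :=
  subst_rec E (dom E) t.

(** * Processes *)

Record process (Act : Type) : Type := Process {
  proc_term :> term Act;
  proc_wf : well_formed proc_term;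
  proc_closed : closed proc_term }.

Section ProcessConstructors.
Context {Act : Type}.
Implicit Types (p q : process Act) (A : Act -> Prop) (al : label Act).

Local Ltac closed_tac :=
  let Z := fresh in let H := fresh in
  intros Z H; inversion H; subst; eapply proc_closed; eassumption.

Definition p_bot : process Act.
Proof. refine (@Process Act Bot (wf_bot _) _). closed_tac. Defined.

Definition p_zero : process Act.
Proof. refine (@Process Act Zero (wf_zero _) _). closed_tac. Defined.

Definition p_prefix al p : process Act.
Proof. refine (@Process Act (Prefix al p) (wf_prefix al (proc_wf p)) _). closed_tac. Defined.

Definition p_box p q : process Act.
Proof. refine (@Process Act (Box p q) (wf_box (proc_wf p) (proc_wf q)) _). closed_tac. Defined.

Definition p_conj p q : process Act.
Proof. refine (@Process Act (Conj p q) (wf_conj (proc_wf p) (proc_wf q)) _). closed_tac. Defined.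

Definition p_disj p q : process Act.
Proof. refine (@Process Act (Disj p q) (wf_disj (proc_wf p) (proc_wf q)) _). closed_tac. Defined.

Definition p_par A p q : process Act.
Proof. refine (@Process Act (Par A p q) (wf_par A (proc_wf p) (proc_wf q)) _). closed_tac. Defined.

End ProcessConstructors.

Definition is_rec (Act : Type) (p : process Act) : Prop :=
  exists Y E, proc_term p = Rec Y E.

(* [p] is [<Y|E>] and [q] is [<t_Y|E>], where [Y = t_Y] is in [E]. *)
Definition unfolds (Act : Type) (p q : process Act) : Prop :=
  exists Y E t, proc_term p = Rec Y E /\ In (Y, t) E /\ proc_term q = unfold_rec t E.

Lemma dom_map (Act : Type) (f : term Act -> term Act) (E : spec Act) :
  dom (map (fun e => (fst e, f (snd e))) E) = dom E.
Proof. unfold dom. rewrite map_map. reflexivity. Qed.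

Lemma in_map_rhs (Act : Type) (f : term Act -> term Act) (E : spec Act) Y t :
  In (Y, t) (map (fun e => (fst e, f (snd e))) E) ->
  exists u, In (Y, u) E /\ t = f u.
Proof.
  intros H. apply in_map_iff in H. destruct H as [[Y' u] [H1 H2]].
  simpl in H1. inversion H1; subst. eauto.
Qed.

Section Unfolding.
#[local] Hint Constructors free_in unguarded_in well_formed : core.

Lemma unguarded_free (Act : Type) (Z : var) (t : term Act) :
  unguarded_in Z t -> free_in Z t.
Proof. induction 1; eauto. Qed.

Context (Act : Type) (X0 : var) (E : spec Act).
Context (Ewf : well_formed (Rec X0 E)) (Ecl : closed (Rec X0 E)).

Lemma rec_closed X : closed (Rec X E).
Proof.
  intros Z H. inversion H; subst. apply (Ecl (Z := Z)). eauto.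
Qed.

Lemma free_subst (t : term Act) : well_formed t -> forall V Z,
  free_in Z (subst_rec E V t) -> free_in Z t /\ ~ In Z V.
Proof.
  induction 1 as [ | | | | | | |X|X G HX Hs Hg _ IH]; intros V Z; simpl; intros Hf.
  1-7: inversion Hf; subst; clear Hf;
       repeat match goal with
       | IH : forall V Z, free_in Z (subst_rec E V ?t) -> _,
         H : free_in _ (subst_rec E _ ?t) |- _ => destruct (IH _ _ H); clear H
       end; split; eauto.
  - destruct (in_dec Nat.eq_dec X V) as [i|i].
    + destruct (rec_closed Hf).
    + inversion Hf; subst. auto.
  - inversion Hf as [ | | | | | | | | | |X' G' Y t Hin Ht Hn]; subst.
    rewrite dom_map in Hn.
    apply in_map_rhs in Hin. destruct Hin as [u [Hu ->]].
    destruct (IH _ _ Hu _ _ Ht) as [Hfu HnV]. split; [eauto|].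
    intros HV. apply HnV. apply set_diff_intro; assumption.
Qed.

Lemma unguarded_subst (t : term Act) : well_formed t -> forall V Z,
  unguarded_in Z (subst_rec E V t) -> unguarded_in Z t.
Proof.
  induction 1 as [ | | | | | | |X|X G HX Hs Hg _ IH]; intros V Z; simpl; intros Hf.
  1-7: inversion Hf; subst; clear Hf; eauto.
  - destruct (in_dec Nat.eq_dec X V) as [i|i]; [|assumption].
    destruct (rec_closed (unguarded_free Hf)).
  - inversion Hf as [ | | | | | | |X' G' Y t Hin Ht Hn]; subst.
    rewrite dom_map in Hn.
    apply in_map_rhs in Hin. destruct Hin as [u [Hu ->]]. eauto.
Qed.

Lemma wf_subst (t : term Act) : well_formed t -> forall V,
  incl V (dom E) -> well_formed (subst_rec E V t).
Proof.
  induction 1 as [ | | | | | | |X|X G HX Hs Hg Hw IH]; intros V HV; simpl; eauto.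
  - destruct (in_dec Nat.eq_dec X V) as [i|i]; [|eauto].
    inversion Ewf; subst. eauto.
  - assert (incl (set_diff Nat.eq_dec V (map fst G)) (dom E)) as HW.
    { intros Z HZ. apply HV. eapply set_diff_elim1; eassumption. }
    constructor; rewrite ?dom_map; auto.
    + intros Y t Z Hin HZ Hu. rewrite dom_map in HZ.
      apply in_map_rhs in Hin. destruct Hin as [u [Hin ->]].
      apply unguarded_subst in Hu; [exact (Hg _ _ _ Hin HZ Hu) | eauto].
    + intros Y t Hin. apply in_map_rhs in Hin. destruct Hin as [u [Hin ->]]. eauto.
Qed.

End Unfolding.

Lemma unfolds_total (Act : Type) (p : process Act) :
  is_rec p -> exists q, unfolds p q.
Proof.
  intros [Y [E HE]]. destruct p as [p Hw Hc]; simpl in HE; subst p.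
  inversion Hw as [ | | | | | | | |X E' HY Hs Hg Hr]; subst.
  apply in_map_iff in HY. destruct HY as [[Y' t] [HY Hin]]. simpl in HY; subst Y'.
  assert (well_formed (unfold_rec t E)) as Hw'.
  { eapply wf_subst; eauto. apply incl_refl. }
  assert (closed (unfold_rec t E)) as Hc'.
  { intros Z HZ. destruct (free_subst Hc (Hr _ _ Hin) HZ) as [Hf Hn].
    apply (Hc Z). eapply free_rec; eassumption. }
  exists (Process Hw' Hc'). exists Y, E, t. auto.
Qed.

(** * Transitions and inconsistency *)

Definition interp (Act : Type) := lts Act (process Act).

(* [step M] and [inc M] are the transitions and the predicate derivable from the
   reduct of the rules by [M]: negative premises, and the conditions that select
   the premises "[y] is in [F]" of a rule with a family of such premises, are
   evaluated in [M]; all other premises have to be derived. *)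
Inductive step (Act : Type) (M : interp Act) :
    process Act -> label Act -> process Act -> Prop :=
| step_prefix al x : step M (p_prefix al x) al x
| step_box_l a x1 x2 y1 :
    step M x1 (vis a) y1 -> ~ can M x2 tau -> step M (p_box x1 x2) (vis a) y1
| step_box_r a x1 x2 y1 :
    step M x1 (vis a) y1 -> ~ can M x2 tau -> step M (p_box x2 x1) (vis a) y1
| step_box_tau_l x1 x2 y1 :
    step M x1 tau y1 -> step M (p_box x1 x2) tau (p_box y1 x2)
| step_box_tau_r x1 x2 y1 :
    step M x1 tau y1 -> step M (p_box x2 x1) tau (p_box x2 y1)
| step_conj a x1 x2 y1 y2 :
    step M x1 (vis a) y1 -> step M x2 (vis a) y2 ->
    step M (p_conj x1 x2) (vis a) (p_conj y1 y2)
| step_conj_tau_l x1 x2 y1 :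
    step M x1 tau y1 -> step M (p_conj x1 x2) tau (p_conj y1 x2)
| step_conj_tau_r x1 x2 y1 :
    step M x1 tau y1 -> step M (p_conj x2 x1) tau (p_conj x2 y1)
| step_disj_l x1 x2 : step M (p_disj x1 x2) tau x1
| step_disj_r x1 x2 : step M (p_disj x1 x2) tau x2
| step_par_tau_l A x1 x2 y1 :
    step M x1 tau y1 -> step M (p_par A x1 x2) tau (p_par A y1 x2)
| step_par_tau_r A x1 x2 y1 :
    step M x1 tau y1 -> step M (p_par A x2 x1) tau (p_par A x2 y1)
| step_par_sync (A : Act -> Prop) a x1 x2 y1 y2 :
    A a -> step M x1 (vis a) y1 -> step M x2 (vis a) y2 ->
    step M (p_par A x1 x2) (vis a) (p_par A y1 y2)
| step_par_l (A : Act -> Prop) a x1 x2 y1 :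
    ~ A a -> step M x1 (vis a) y1 -> ~ can M x2 tau ->
    step M (p_par A x1 x2) (vis a) (p_par A y1 x2)
| step_par_r (A : Act -> Prop) a x1 x2 y1 :
    ~ A a -> step M x1 (vis a) y1 -> ~ can M x2 tau ->
    step M (p_par A x2 x1) (vis a) (p_par A x2 y1)
| step_rec x x' al y : unfolds x x' -> step M x' al y -> step M x al y.

Inductive inc (Act : Type) (M : interp Act) : process Act -> Prop :=
| inc_bot : inc M p_bot
| inc_prefix al x : inc M x -> inc M (p_prefix al x)
| inc_disj x1 x2 : inc M x1 -> inc M x2 -> inc M (p_disj x1 x2)
| inc_box_l x1 x2 : inc M x1 -> inc M (p_box x1 x2)
| inc_box_r x1 x2 : inc M x2 -> inc M (p_box x1 x2)
| inc_par_l A x1 x2 : inc M x1 -> inc M (p_par A x1 x2)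
| inc_par_r A x1 x2 : inc M x2 -> inc M (p_par A x1 x2)
| inc_conj_l x1 x2 : inc M x1 -> inc M (p_conj x1 x2)
| inc_conj_r x1 x2 : inc M x2 -> inc M (p_conj x1 x2)
| inc_conj_ready_l a x1 x2 y1 :
    step M x1 (vis a) y1 -> ~ can M x2 (vis a) -> ~ can M (p_conj x1 x2) tau ->
    inc M (p_conj x1 x2)
| inc_conj_ready_r a x1 x2 y2 :
    ~ can M x1 (vis a) -> step M x2 (vis a) y2 -> ~ can M (p_conj x1 x2) tau ->
    inc M (p_conj x1 x2)
| inc_conj_next al x1 x2 z :
    step M (p_conj x1 x2) al z ->
    (forall y, trans M (p_conj x1 x2) al y -> inc M y) ->
    inc M (p_conj x1 x2)
| inc_conj_stable x1 x2 :
    (forall y, eps_stable M (p_conj x1 x2) y -> inc M y) ->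
    inc M (p_conj x1 x2)
| inc_rec x x' : unfolds x x' -> inc M x' -> inc M x
| inc_rec_stable x :
    is_rec x -> (forall y, eps_stable M x y -> inc M y) -> inc M x.

Definition stable_model (Act : Type) (M : interp Act) : Prop :=
  (forall p al q, trans M p al q <-> step M p al q) /\
  (forall p, incons M p <-> inc M p).

(** * There is exactly one stable model *)

Lemma step_tau_indep (Act : Type) (M N : interp Act) p al q :
  step M p al q -> al = tau -> step N p al q.
Proof.
  induction 1; intros Hal; try discriminate Hal;
    try (constructor; auto; fail).
  eapply step_rec; eauto.
Qed.

Lemma step_ext (Act : Type) (M N : interp Act) :
  (forall p, can M p tau <-> can N p tau) ->
  forall p al q, step M p al q -> step N p al q.
Proof.
  intros HMN. induction 1; try (constructor; auto; rewrite <- HMN; auto; fail).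
  eapply step_rec; eauto.
Qed.

Lemma inc_ext (Act : Type) (M N : interp Act) :
  (forall p al q, trans M p al q <-> trans N p al q) ->
  forall p, inc M p -> inc N p.
Proof.
  intros HMN.
  assert (forall p al, can M p al <-> can N p al) as Hc.
  { intros p al. split; intros [q Hq]; exists q; apply HMN; exact Hq. }
  assert (forall p al q, step M p al q -> step N p al q) as Hs.
  { apply step_ext. intros p. apply Hc. }
  assert (forall p q, eps_stable N p q -> eps_stable M p q) as He.
  { intros p q [H1 H2]. split.
    - clear H2. induction H1; [apply rt_step; apply HMN; assumption | apply rt_refl |
        eapply rt_trans; eassumption].
    - rewrite Hc. exact H2. }
  induction 1; try (constructor; auto; fail).
  - eapply inc_conj_ready_l; [eauto | rewrite <- Hc .. ]; eauto.
  - eapply inc_conj_ready_r; [rewrite <- Hc | | rewrite <- Hc]; eauto.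
  - eapply inc_conj_next; [eauto | intros y Hy; apply HMN in Hy; auto].
  - eapply inc_rec; eauto.
Qed.

Lemma stable_model_exists (Act : Type) : exists M : interp Act, stable_model M.
Proof.
  pose (M0 := Lts (fun (_ : process Act) (_ : label Act) (_ : process Act) => False)
                  (fun _ => False)).
  pose (M1 := Lts (step M0) (fun _ => False)).
  pose (M2 := Lts (step M1) (fun _ => False)).
  pose (M3 := Lts (step M1) (inc M2)).
  assert (forall p, can M1 p tau <-> can M3 p tau) as H13.
  { intros p. split; intros [q Hq]; exists q; eapply step_tau_indep; eauto; exact Hq. }
  exists M3. split; simpl.
  - intros p al q. split; apply step_ext; firstorder.
  - intros p. split; apply inc_ext; simpl; tauto.
Qed.

Lemma stable_model_unique (Act : Type) (M N : interp Act) :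
  stable_model M -> stable_model N ->
  (forall p al q, trans M p al q <-> trans N p al q) /\
  (forall p, incons M p <-> incons N p).
Proof.
  intros [HM HMF] [HN HNF].
  assert (forall p, can M p tau <-> can N p tau) as Ht.
  { intros p. split; intros [q Hq]; exists q.
    - apply HN. apply HM in Hq. eapply step_tau_indep; eauto.
    - apply HM. apply HN in Hq. eapply step_tau_indep; eauto. }
  assert (forall p al q, trans M p al q <-> trans N p al q) as HT.
  { intros p al q. rewrite HM, HN. split; apply step_ext; firstorder. }
  split; [exact HT|].
  intros p. rewrite HMF, HNF. split; apply inc_ext; firstorder.
Qed.

(* Main.v *)
Require Import Defs.
From Stdlib Require Import List Sorting.Sorted Lia ProofIrrelevance.

(** Induct on the derivation of a visible transition ([step_vis_not_tau]). A prefix has only the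
    label it carries, and disjunctions have only tau steps. In a box or an asynchronous parallel
    step, the moving side has no tau step by induction and the other has none by the negative
    premise; in a synchronised or conjunctive step, induction covers both sides. A recursive process
    acts as its unfolding, which is unique ([unfolds_functional]). *)

Lemma process_eq (Act : Type) (p q : process Act) :
  proc_term p = proc_term q -> p = q.
Proof.
  destruct p as [t Hw Hc], q as [u Kw Kc]; simpl; intros ->.
  f_equal; apply proof_irrelevance.
Qed.

Lemma sorted_spec_functional (Act : Type) (E : spec Act) Y t u :
  StronglySorted lt (dom E) -> In (Y, t) E -> In (Y, u) E -> t = u.
Proof.
  assert (forall Z (E' : spec Act) v, Forall (lt Z) (dom E') -> ~ In (Z, v) E') as Hhd.
  { intros Z E' v HE' Hin. rewrite Forall_forall in HE'.
    specialize (HE' Z (in_map fst _ _ Hin)). lia. }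
  induction E as [|[X v] E IH]; simpl; intros HE; [tauto|].
  inversion HE; subst.
  intros [Ht|Ht] [Hu|Hu].
  - congruence.
  - inversion Ht; subst. exfalso; eapply Hhd; eassumption.
  - inversion Hu; subst. exfalso; eapply Hhd; eassumption.
  - auto.
Qed.

(** Well-formedness of [p] sorts the left-hand sides strictly, so each variable has a single
    equation. *)
Lemma unfolds_functional (Act : Type) (p q r : process Act) :
  unfolds p q -> unfolds p r -> q = r.
Proof.
  intros (X & E & t & Hp & Ht & Hq) (Y & G & u & Hp' & Hu & Hr).
  assert (X = Y /\ E = G) as [<- <-] by (split; congruence).
  apply process_eq. rewrite Hq, Hr. f_equal.
  pose proof (proc_wf p) as Hw. rewrite Hp in Hw. inversion Hw; subst.
  eapply sorted_spec_functional; eassumption.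
Qed.

(** Negative premises are evaluated in [M], whereas tau steps are derived; the hypothesis on [M]
    lets a derived tau step refute such a premise. *)
Lemma step_vis_not_tau (Act : Type) (M : interp Act) p a q :
  (forall r s, step M r tau s -> can M r tau) ->
  step M p (vis a) q -> forall r, ~ step M p tau r.
Proof.
  intros HM Hv. remember (vis a) as al eqn:Hal.
  induction Hv as [ | | | | | | | | | | | | | | |x x' al q Hu Hv IH];
    intros r Ht; try discriminate Hal; unfold not in *;
    (* [p_box] and its kin are not constructors, so sources are compared as terms and [process_eq]
       then recovers the components. *)
    match type of Ht with step _ ?p _ _ => remember p as p0 eqn:Hp end;
    apply (f_equal (@proc_term Act)) in Hp; simpl in Hp.
  all: try (inversion Ht; subst; simpl in Hp; try discriminate Hp;
    try match goal with
    | Hu : unfolds ?p _, Hp : proc_term ?p = _ |- _ =>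
        destruct Hu as (? & ? & ? & ? & _); congruence
    end;
    injection Hp; intros; subst;
    repeat match goal with
    | H : proc_term _ = proc_term _ |- _ => apply process_eq in H; subst
    end; eauto; fail).
  (* Only the recursion rule remains: both derivations go through the same unfolding. *)
  apply process_eq in Hp; subst p0.
  inversion Ht; subst;
    try (destruct Hu as (? & ? & ? & Hp & _); discriminate Hp).
  eapply IH; [reflexivity|].
  erewrite (unfolds_functional _ _ _ _ Hu); eassumption.
Qed.

Theorem mainTheorem5 (Act : Type) (LTS : interp Act) (HLTS : stable_model LTS) :
  tau_pure LTS.
Proof.
  destruct HLTS as [HT _]. intros p [q Hq] (a & r & Hr).
  apply HT in Hq, Hr. eapply step_vis_not_tau; [|eassumption..].
  intros x y Hxy. exists y. apply HT. exact Hxy.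
Qed.
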